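(* Let $D=(V,A)$ be a finite loopless digraph, $F\subseteq A$ a non-empty subset of edges, $B$ an integral $0$-base-polyhedron, and $f:A\to\mathbb{Z}\cup\{-\infty\}$, $g:A\to\mathbb{Z}\cup\{+\infty\}$ with $f\le g$ such that $Q=Q(f,g;B)$ is non-empty. Then there exists a (not necessarily integral) element of $Q$ that is $F$-dec-min in $Q$ if and only if the digraph $D^*=(V,A^* )$ has no directed circuit containing an edge of $F$.
   Context: For $x\in\mathbb{R}^V$, $\widetilde x(Z)=\sum_{v\in Z}x(v)$. A base-polyhedron is $B'(p)=\{x:\widetilde x(V)=p(V),\ \widetilde x(Z)\ge p(Z)\ \forall Z\subset V\}$ with $p:2^V\to\mathbb{Z}\cup\{-\infty\}$, $p(\emptyset)=0$, $p(V)$ finite, $p(X)+p(Y)\le p(X\cap Y)+p(X\cup Y)$; $0$-base-polyhedron: $p(V)=0$; integral: $p$ integer-valued where finite. For $x:A\to\mathbb{R}$, $\psi_x(v)=\sum_{uv\in A}x(uv)-\sum_{vu\in A}x(vu)$; $Q(f,g;B)=\{x\in\mathbb{R}^A:f\le x\le g,\ \psi_x\in B\}$. Let $\mathcal P=\{Z\subseteq V:\min\{\widetilde x(Z):x\in B\}>-\infty\}$; it is closed under union and intersection and contains $V$, so each $u\in V$ lies in a unique smallest member $P(u)$ of $\mathcal P$. Jumping edges: $J=\{uv: v\in P(u)-u\}$. Let $A_1=\{e\in A: f(e)=-\infty\}$ (edges of $D$, same orientation) and $A_2=\{vu: uv\in A-F,\ g(uv)=+\infty\}$ (reversed copies). $A^*$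 is the disjoint union $J\cup A_1\cup A_2$ (a multigraph); the edges of $F$ that can occur in $A^*$ are those of $A_1\cap F$. For $y,y'\in\mathbb{R}^F$, $y$ is decreasingly smaller than $y'$ if its decreasingly sorted component sequence is lexicographically smaller; $z\in Q$ is $F$-dec-min in $Q$ if no $z'\in Q$ has $z'|_F$ decreasingly smaller than $z|_F$. *)

(* Defs.v *)
From mathcomp Require Import all_boot all_order all_algebra.
From mathcomp Require Import boolp classical_sets reals ereal.

Set Implicit Arguments.
Unset Strict Implicit.
Unset Printing Implicit Defensive.

Import Order.TTheory GRing.Theory Num.Theory.

Local Open Scope classical_set_scope.
Local Open Scope ring_scope.

(* The functions into int extended by one infinite value, p, f and g, are taken
   in \bar int; the other infinite value is excluded explicitly. *)
Definition ext_int (R : realType) : \bar int -> \bar R :=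
  er_map (fun k : int => k%:~R).

Section BasePolyhedron.
Context {R : realType} {V : finType}.
Implicit Types (x : V -> R) (Z : {set V}) (p : {set V} -> \bar int).
Implicit Types (B : set (V -> R)).

Definition sum_on x Z : R := \sum_(v in Z) x v.

Definition supermodular p : Prop :=
  forall X Y : {set V}, (p X + p Y <= p (X :&: Y) + p (X :|: Y))%E.

Definition int_base_function p : Prop :=
  [/\ forall Z, p Z != +oo%E, p finset.set0 = 0%E, p [set: V]%SET \is a fin_num
    & supermodular p].

Definition base_polyhedron p : set (V -> R) :=
  [set x | (sum_on x [set: V]%SET)%:E = ext_int R (p [set: V]%SET) /\
           forall Z, (ext_int R (p Z) <= (sum_on x Z)%:E)%E].

Definition integral_0_base_polyhedron B : Prop :=
  exists p, [/\ int_base_function p, p [set: V]%SET = 0%E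
              & B = base_polyhedron p].

(* The family written \mathcal P; over a non-empty polyhedron a linear function
   that is bounded below attains its infimum, so ereal_inf is the minimum. *)
Definition bounded_family B : set {set V} :=
  [set Z | (-oo < ereal_inf [set (sum_on x Z)%:E | x in B])%E].

(* Z is P(u) *)
Definition smallest_member B (u : V) Z : Prop :=
  [/\ bounded_family B Z, u \in Z
    & forall Y, bounded_family B Y -> u \in Y -> Z \subset Y].

Definition jumping B (u v : V) : Prop :=
  exists2 Z, smallest_member B u Z & v \in (Z :\ u)%SET.

End BasePolyhedron.

(* The digraph is given by its edge type A and the end maps src, tgt, so that
   parallel edges are allowed. *)
Section Submodular_flow.
Context {R : realType} {V A : finType}.
Variables (src tgt : A -> V).
Implicit Types (x : A -> R) (f g : A -> \bar int) (B : set (V -> R)).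
Implicit Types (F : {set A}).

Definition psi x (v : V) : R :=
  \sum_(e | tgt e == v) x e - \sum_(e | src e == v) x e.

Definition flow_polyhedron f g B : set (A -> R) :=
  [set x | (forall e, (ext_int R (f e) <= (x e)%:E <= ext_int R (g e))%E) /\
           B (psi x)].

Definition dec_sorted F x : seq R := sort >=%R [seq x e | e in F].

Definition dec_smaller F x x' : Prop :=
  ((dec_sorted F x : seqlexi R) < (dec_sorted F x' : seqlexi R))%O.

Definition dec_min F (Q : set (A -> R)) z : Prop :=
  Q z /\ ~ exists2 z', Q z' & dec_smaller F z' z.

(* Candidate edges of the multigraph D^*: inl (u, v) is the jumping edge uv,
   inr (inl e) the copy of e with the same orientation and inr (inr e) the
   reversed copy of e. *)
Definition star_edge : Type := ((V * V) + (A + A))%type.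

Definition star_src (a : star_edge) : V :=
  match a with
  | inl uv => uv.1
  | inr (inl e) => src e
  | inr (inr e) => tgt e
  end.

Definition star_tgt (a : star_edge) : V :=
  match a with
  | inl uv => uv.2
  | inr (inl e) => tgt e
  | inr (inr e) => src e
  end.

Definition in_star F f g B (a : star_edge) : Prop :=
  match a with
  | inl uv => jumping B uv.1 uv.2
  | inr (inl e) => f e = -oo%E
  | inr (inr e) => e \notin F /\ g e = +oo%E
  end.

(* The vertices of a circuit are pairwise distinct. *)
Definition star_circuit F f g B (c : seq star_edge) : Prop :=
  [/\ c != [::], forall a, a \in c -> in_star F f g B a,
      cycle (fun a b => star_tgt a == star_src b) c
    & uniq [seq star_src a | a <- c]].

Definition star_circuit_through_F F f g B : Prop :=
  exists c, star_circuit F f g B c /\ exists2 e, e \in F & inr (inl e) \in c.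

End Submodular_flow.

(* Main.v *)
(** A circuit of [D^*] through an edge of [F] lets one push every element of
    [Q] along the circuit; no edge of [F] increases and at least one decreases,
    so nothing is dec-min.

    Conversely, let [e] be an edge of [F] with [f e = -oo] and let [S] be the
    set of vertices reachable in [D^*] from the head of [e]. If no circuit of
    [D^*] meets [F] then [S] misses the tail of [e], and, no edge of [D^*]
    leaving [S], the inequality [p S <= psi_x(S)] bounds [x e] from below as
    soon as the values of [x] on [F] are bounded above. Hence on the elements of
    [Q] not exceeding a given one in maximum all [F]-coordinates are bounded.
    There a dec-min element exists because a coordinate that is bounded below
    on a polyhedron attains its minimum (Fourier-Motzkin elimination). *)

Require Import Defs.
From mathcomp Require Import all_boot all_order all_algebra.
From mathcomp Require Import boolp classical_sets reals ereal.
From mathcomp Require Import lra.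

Set Implicit Arguments.
Unset Strict Implicit.
Unset Printing Implicit Defensive.

Import Order.TTheory GRing.Theory Num.Theory.

Local Open Scope ring_scope.

(** * Finite systems of linear inequalities and their closure properties *)

Section Polyhedra.
Context {R : realType} {I : finType}.
Implicit Types (P : (I -> R) -> Prop) (x y : I -> R).

(** The index type of the inequalities is existential, so that conjunction and elimination can each
    supply their own. *)
Definition polyhedral P : Prop :=
  exists (J : finType) (a : J -> I -> R) (b : J -> R),
    forall x, P x <-> forall j, \sum_i a j i * x i <= b j.

Lemma polyhedral_ext P P' :
  (forall x, P x <-> P' x) -> polyhedral P -> polyhedral P'.
Proof.
by move=> PP' [J [a [b Pab]]]; exists J, a, b => x; rewrite -PP'.
Qed.

Lemma polyhedral_true : polyhedral (fun=> True).
Proof. by exists void, (fun=> fun=> 0), (fun=> 0) => x; split=> // _ []. Qed.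

Lemma polyhedral_halfspace (a : I -> R) (b : R) :
  polyhedral (fun x => \sum_i a i * x i <= b).
Proof. by exists unit, (fun=> a), (fun=> b) => x; split=> [//|/(_ tt)]. Qed.

Lemma polyhedral_and P1 P2 :
  polyhedral P1 -> polyhedral P2 -> polyhedral (fun x => P1 x /\ P2 x).
Proof.
move=> [J1 [a1 [b1 P1ab]]] [J2 [a2 [b2 P2ab]]].
exists (J1 + J2)%type,
  (fun j => match j with inl j => a1 j | inr j => a2 j end),
  (fun j => match j with inl j => b1 j | inr j => b2 j end) => x.
rewrite P1ab P2ab; split=> [[le1 le2] [j|j] //|le12].
by split=> j; [apply: (le12 (inl j))|apply: (le12 (inr j))].
Qed.

Lemma polyhedral_impl (H : Prop) P :
  polyhedral P -> polyhedral (fun x => H -> P x).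
Proof.
have [h|nh] := pselect H; last first.
  by move=> _; apply: polyhedral_ext polyhedral_true => x; split.
by apply: polyhedral_ext => x; split=> // /(_ h).
Qed.

Lemma polyhedral_forall_seq (K : eqType) (s : seq K)
    (P : K -> (I -> R) -> Prop) :
  (forall k, polyhedral (P k)) ->
  polyhedral (fun x => forall k, k \in s -> P k x).
Proof.
move=> polyP; elim: s => [|k s IHs].
  by apply: polyhedral_ext polyhedral_true => x; split=> // _.
apply: polyhedral_ext (polyhedral_and (polyP k) IHs) => x.
split=> [[Pk Ps] l|Pks]; first by rewrite inE => /predU1P[->|/Ps].
by split=> [|l ls]; apply: Pks; rewrite inE ?eqxx ?ls ?orbT.
Qed.

Lemma polyhedral_forall (K : finType) (P : K -> (I -> R) -> Prop) :
  (forall k, polyhedral (P k)) -> polyhedral (fun x => forall k, P k x).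
Proof.
move=> /(polyhedral_forall_seq (enum K)); apply: polyhedral_ext => x.
by split=> Px k; [apply: Px; rewrite mem_enum|move=> _; apply: Px].
Qed.

Lemma sum_delta (i : I) x : \sum_k (k == i)%:R * x k = x i.
Proof.
rewrite (bigD1 i) //= eqxx mul1r big1 ?addr0 // => k /negbTE ->.
by rewrite mul0r.
Qed.

Lemma polyhedral_le_const (i : I) (m : R) : polyhedral (fun x => x i <= m).
Proof.
apply: polyhedral_ext (polyhedral_halfspace (fun k => (k == i)%:R) m) => x.
by rewrite sum_delta.
Qed.

Lemma polyhedral_ge_const (i : I) (m : R) : polyhedral (fun x => m <= x i).
Proof.
apply: polyhedral_ext
  (polyhedral_halfspace (fun k => - (k == i)%:R) (- m)) => x.
under eq_bigr do rewrite mulNr.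
by rewrite sumrN sum_delta lerN2.
Qed.

Lemma polyhedral_ge (i k : I) : polyhedral (fun x => x k <= x i).
Proof.
apply: polyhedral_ext
  (polyhedral_halfspace (fun l => (l == k)%:R - (l == i)%:R) 0) => x.
under eq_bigr do rewrite mulrBl.
by rewrite sumrB !sum_delta subr_le0.
Qed.

(** * Elimination of variables and attainment of minima *)

Lemma seq_between (ls us : seq R) :
  (forall l u, l \in ls -> u \in us -> l <= u) ->
  exists t, (forall l, l \in ls -> l <= t) /\ (forall u, u \in us -> t <= u).
Proof.
elim: ls => [_|l ls IHls le_lu].
  elim: us => [|u us [t [_ le_t]]]; first by exists 0.
  exists (Num.min u t); split=> // v; rewrite inE => /predU1P[->|/le_t le_tv].
    by rewrite ge_min lexx.
  by rewrite ge_min le_tv orbT.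
case: IHls => [k u k_ls u_us|t [ge_t le_t]].
  by apply: le_lu; rewrite // inE k_ls orbT.
exists (Num.max l t); split=> [k|u u_us].
  by rewrite inE le_max => /predU1P[->|/ge_t ->]; rewrite ?lexx ?orbT.
by rewrite ge_max le_t ?andbT // le_lu ?mem_head.
Qed.

(** A positive [a j] gives an upper bound on [t], a negative one a lower bound, and a zero one a
    condition on [c j] alone. Every lower bound must lie below every upper bound; this is stated
    with denominators cleared. *)
Lemma Fourier_Motzkin (J : finType) (a c : J -> R) :
  (exists t, forall j, a j * t <= c j) <->
  (forall j, a j = 0 -> 0 <= c j) /\
  (forall j k, 0 < a j -> a k < 0 -> a k * c j <= a j * c k).
Proof.
split=> [[t le_t]|[c_ge0 le_c]].
  split=> [j aj0|j k aj ak]; first by have := le_t j; rewrite aj0 mul0r.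
  have := ler_wnM2l (ltW ak) (le_t j); have := ler_wpM2l (ltW aj) (le_t k).
  by move=> le1 le2; apply: le_trans le2 _; rewrite mulrCA.
have [|t [ge_t le_t]] := @seq_between
    [seq c k / a k | k <- enum J & a k < 0] [seq c j / a j | j <- enum J & 0 < a j].
  move=> l u /mapP[k]; rewrite mem_filter => /andP[ak _] ->.
  move=> /mapP[j]; rewrite mem_filter => /andP[aj _] ->.
  rewrite ler_ndivrMr // mulrAC ler_pdivrMr // mulrC [leRHS]mulrC.
  exact: le_c.
exists t => j; have [aj|aj|aj] := ltgtP (a j) 0.
- rewrite mulrC -ler_ndivrMr //; apply: ge_t; apply: map_f.
  by rewrite mem_filter aj mem_enum.
- rewrite mulrC -ler_pdivlMr //; apply: le_t; apply: map_f.
  by rewrite mem_filter aj mem_enum.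
- by rewrite aj mul0r c_ge0.
Qed.

(** For fixed other coordinates the system in [t] has right-hand sides affine in [x], so its
    solvability conditions are linear in [x]. The result stays a predicate on [I -> R], with
    coordinate [i] free, so that elimination can be iterated. *)
Lemma polyhedral_elim (i : I) P :
  polyhedral P -> polyhedral (fun x => exists t, P [eta x with i |-> t]).
Proof.
move=> [J [a [b Pab]]].
pose r j x := \sum_(k | k != i) a j k * x k.
have polyr0 j : polyhedral (fun x => a j i = 0 -> r j x <= b j).
  have [aj0|aj0] := pselect (a j i = 0); last first.
    by apply: polyhedral_ext polyhedral_true => x; split.
  apply: polyhedral_ext (polyhedral_halfspace (a j) (b j)) => x.
  by rewrite (bigD1 i) //= aj0 mul0r add0r; split=> [//|/(_ erefl)].
have polyr jk : polyhedral (fun x => 0 < a jk.1 i -> a jk.2 i < 0 ->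
    a jk.2 i * (b jk.1 - r jk.1 x) <= a jk.1 i * (b jk.2 - r jk.2 x)).
  case: jk => j k /=; do 2 apply: polyhedral_impl.
  (* The coefficient at [l = i] cancels, so [x i] does not enter this inequality. *)
  apply: polyhedral_ext (polyhedral_halfspace
    (fun l => a j i * a k l - a k i * a j l) (a j i * b k - a k i * b j)) => x.
  have -> : \sum_l (a j i * a k l - a k i * a j l) * x l
      = a j i * r k x - a k i * r j x.
    rewrite (bigD1 i) //= [a k i * _]mulrC subrr mul0r add0r.
    rewrite /r !mulr_sumr -sumrB; apply: eq_bigr => l _.
    by rewrite mulrBl !mulrA.
  by rewrite !mulrBr; split; lra.
apply: polyhedral_ext
  (polyhedral_and (polyhedral_forall polyr0) (polyhedral_forall polyr)) => x.
have Pupd t : P [eta x with i |-> t] <-> forall j, a j i * t <= b j - r j x.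
  rewrite Pab; split=> le_b j; have := le_b j.
    rewrite (bigD1 i) //= eqxx lerBrDr; congr (_ + _ <= _).
    by apply: eq_bigr => k /negbTE ->.
  rewrite lerBrDr (bigD1 i) //= eqxx; congr (_ + _ <= _).
  by apply: eq_bigr => k /negbTE ->.
have -> : (exists t, P [eta x with i |-> t]) <->
    exists t, forall j, a j i * t <= b j - r j x.
  by split=> -[t /Pupd]; exists t => //; apply/Pupd.
rewrite Fourier_Motzkin; split=> -[le0 le].
  by split=> [j /le0|j k]; [rewrite subr_ge0|apply: (le (j, k))].
by split=> [j /le0|[j k]]; [rewrite subr_ge0|apply: le].
Qed.

Lemma polyhedral_proj (s : seq I) P : polyhedral P ->
  polyhedral (fun x => exists2 y, P y & forall k, k \notin s -> y k = x k).
Proof.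
move=> polyP; elim: s => [|i s IHs].
  apply: polyhedral_ext polyP => x; split=> [Px|[y Py yx]]; first by exists x.
  by rewrite (_ : x = y) //; apply/funext => k; rewrite yx.
apply: polyhedral_ext (polyhedral_elim i IHs) => x.
split=> [[t [y Py yx]]|[y Py yx]].
  exists y => // k; rewrite inE negb_or => /andP[/negbTE ki ks].
  by rewrite yx //= ki.
exists (y i), y => // k ks /=; case: eqP => [->//|/eqP ki].
by rewrite yx // inE negb_or ki.
Qed.

(** Eliminating all other coordinates leaves a subset of the line cut out by finitely many weak
    inequalities, which contains its infimum. *)
Lemma coordinate_min_attained (i : I) P (m : R) :
    polyhedral P -> (exists x, P x) -> (forall x, P x -> m <= x i) ->
  exists2 x, P x & forall y, P y -> x i <= y i.
Proof.
move=> polyP [x0 Px0] le_m.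
have [J [a [b Pab]]] := polyhedral_proj (enum (predC1 i)) polyP.
(* Only coordinate [i] survives the projection, so the value [t] is represented by the constant
   function [t]. *)
pose T := [set t : R | forall j, (\sum_k a j k) * t <= b j]%classic.
have TP t : T t <-> exists2 y, P y & y i = t.
  have -> : T t <-> forall j, \sum_k a j k * t <= b j.
    by split=> Tt j; have := Tt j; rewrite mulr_suml.
  rewrite -(Pab (fun=> t)); split=> -[y Py yt]; exists y => //.
    by apply: yt; rewrite mem_enum !inE eqxx.
  by move=> k; rewrite mem_enum !inE negbK => /eqP ->.
have T0 : (T !=set0)%classic by exists (x0 i); apply/TP; exists x0.
have Tm : lbound T m by move=> t /TP[y Py <-]; apply: le_m.
have infT : has_inf T by split=> //; exists m.
have /TP[x Px xi] : T (inf T).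
  (* With a nonnegative coefficient the inequality passes down from any point of [T]; with a
     negative one it is a lower bound of [T], hence of its infimum. *)
  move=> j; have [a_ge0|a_lt0] := leP 0 (\sum_k a j k).
    have [t Tt] := T0; apply: le_trans (Tt j).
    by rewrite ler_wpM2l // ge_inf //; case: infT.
  rewrite mulrC -ler_ndivrMr //; apply: lb_le_inf => // t Tt.
  by rewrite ler_ndivrMr // mulrC; apply: Tt.
exists x => // y Py; rewrite xi ge_inf //; first by case: infT.
by apply/TP; exists y.
Qed.

(** Minimize the first coordinate, then recurse on the set of its minimizers, which is again
    polyhedral. *)
Lemma lexmin_attained (s : seq I) P :
    polyhedral P -> (exists x, P x) ->
    (forall i, i \in s -> exists m, forall x, P x -> m <= x i) ->
  exists2 x, P x & forall y, P y ->
    ((map x s : seqlexi R) <= (map y s : seqlexi R))%O.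
Proof.
elim: s P => [|i s IHs] P polyP P0 bnd; first by case: P0 => x Px; exists x.
have [m mP] := bnd i (mem_head _ _).
have [x1 Px1 x1_min] := coordinate_min_attained polyP P0 mP.
have [||k ks|x [Px le_xi] x_min] := IHs (fun x => P x /\ x i <= x1 i).
- exact: polyhedral_and (polyhedral_le_const _ _).
- by exists x1.
- have [|n nP] := bnd k; first by rewrite inE ks orbT.
  by exists n => x [/nP].
exists x => // y Py; rewrite /= lexi_cons (le_trans le_xi (x1_min y Py)) /=.
apply/implyP => le_yx; apply: x_min; split=> //.
exact: le_trans le_yx le_xi.
Qed.

End Polyhedra.

(** * Decreasingly sorted vectors and their lexicographic order *)

Section DecreasingOrder.
Context {R : realType} {A : finType}.
Implicit Types (F : {set A}) (x y : A -> R).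

Lemma ger_total : total (>=%R : rel R).
Proof. by move=> a b; apply: le_total. Qed.

Lemma ger_trans : transitive (>=%R : rel R).
Proof. by move=> a b c ba ac; apply: le_trans ac ba. Qed.

Lemma ger_anti : antisymmetric (>=%R : rel R).
Proof. by move=> a b; rewrite andbC => /le_anti. Qed.

(** Replaces sorting by a fixed order of [F], along which the sorted vector depends linearly on
    [x]. *)
Lemma dec_sortedE F x (s : seq A) :
    perm_eq s (enum F) -> sorted >=%R (map x s) ->
  dec_sorted F x = map x s.
Proof.
move=> s_perm s_sorted; apply: (sorted_eq ger_trans ger_anti) => //.
  exact: sort_sorted ger_total _.
by rewrite perm_sort perm_sym; apply: perm_map.
Qed.

Lemma dec_order F x :
  exists2 s, perm_eq s (enum F) & sorted >=%R (map x s).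
Proof.
exists (sort (fun e e' => x e >= x e') (enum F)); first by rewrite perm_sort.
by rewrite sorted_map; apply: sort_sorted => e e'; apply: ger_total.
Qed.

(** The head of the decreasing arrangement is a maximum, so no other arrangement starts higher; on a
    tie the heads cancel. *)
Lemma seqlexi_le_sorted (s t : seq R) : perm_eq s t -> sorted >=%R t ->
  ((s : seqlexi R) <= (t : seqlexi R))%O.
Proof.
elim: s t => [|a s IHs] t; first by rewrite lexi0s.
case: t => [|b t] p_st t_sorted; first by have := perm_size p_st.
have le_ab : a <= b.
  have := mem_head a s; rewrite (perm_mem p_st) inE => /predU1P[->//|].
  have := order_path_min ger_trans t_sorted => /allP; exact.
rewrite lexi_cons le_ab /=; apply/implyP => le_ba.
have ab : a = b by apply/le_anti; rewrite le_ab.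
by apply: IHs (path_sorted t_sorted); move: p_st; rewrite ab perm_cons.
Qed.

(** Along an order that sorts [x], the vector of [x] is lexicographically below that of [y], and
    sorting [y] only increases the latter. *)
Lemma dec_smaller_le F x y (e0 : A) :
    (forall e, e \in F -> x e <= y e) -> e0 \in F -> x e0 < y e0 ->
  dec_smaller F x y.
Proof.
move=> le_xy e0F lt_xy; have [s s_perm s_sorted] := dec_order F x.
rewrite /dec_smaller (dec_sortedE s_perm s_sorted).
apply: (@lt_le_trans _ _ (map y s : seqlexi R)); last first.
  apply: seqlexi_le_sorted; last exact: sort_sorted ger_total _.
  by rewrite perm_sym perm_sort perm_sym; apply: perm_map.
have : e0 \in s by rewrite (perm_mem s_perm) mem_enum.
have : {subset s <= F} by move=> e; rewrite (perm_mem s_perm) mem_enum.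
elim: s {s_perm s_sorted} => //= e s IHs sF; rewrite inE => e0s.
have le_e : x e <= y e by apply/le_xy/sF/mem_head.
rewrite ltxi_cons le_e /=; apply/implyP => le_yx; apply: IHs.
  by move=> k ks; apply: sF; rewrite inE ks orbT.
by case/predU1P: e0s => // e0e; move: lt_xy; rewrite e0e ltNge le_yx.
Qed.

(** The first sorted entry is the maximum over [F], and it cannot grow when passing to a
    decreasingly smaller vector. *)
Lemma dec_smaller_bound F x y (M : R) : dec_smaller F x y ->
  (forall e, e \in F -> y e <= M) -> forall e, e \in F -> x e <= M.
Proof.
have [s s_perm s_sorted] := dec_order F x.
have [t t_perm t_sorted] := dec_order F y.
rewrite /dec_smaller (dec_sortedE s_perm s_sorted).
rewrite (dec_sortedE t_perm t_sorted).
move=> lt_st le_M e; rewrite -mem_enum -(perm_mem s_perm).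
case: s {s_perm} s_sorted lt_st => //= a s s_sorted.
case: t {t_sorted} t_perm => //= b t t_perm.
rewrite ltxi_cons => /andP[le_ab _].
have le_bM : y b <= M.
  by apply: le_M; rewrite -mem_enum -(perm_mem t_perm) mem_head.
rewrite inE => /predU1P[->|es]; first exact: le_trans le_bM.
apply: le_trans (le_trans le_ab le_bM).
by apply: (allP (order_path_min ger_trans s_sorted)); apply: map_f.
Qed.

Lemma polyhedral_sorted (s : seq A) :
  polyhedral (fun x => sorted >=%R (map x s)).
Proof.
case: s => [|e s] /=.
  by apply: polyhedral_ext polyhedral_true.
elim: s e => [|k s IHs] e /=.
  by apply: polyhedral_ext polyhedral_true.
apply: polyhedral_ext (polyhedral_and (polyhedral_ge e k) (IHs k)) => x.
by split=> /andP.
Qed.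

(* Ordering [F] by a permutation along which [x] decreases cuts the polyhedron
   into finitely many polyhedra, on each of which dec-min means lex-min. *)
Lemma dec_min_attained F (P : (A -> R) -> Prop) :
    polyhedral P -> (exists x, P x) ->
    (forall e, e \in F -> exists m, forall x, P x -> m <= x e) ->
  exists2 x, P x & forall y, P y ->
    ((dec_sorted F x : seqlexi R) <= (dec_sorted F y : seqlexi R))%O.
Proof.
move=> polyP [x0 Px0] bnd.
(* [U L] is the union of the pieces of [P] sorted by some order in [L]. Induction on [L] compares
   the minimum of one piece with that of the remaining union; either may be empty. *)
pose U (L : seq (seq A)) y := P y /\
  exists2 s, s \in L & sorted >=%R (map y s).
have Uall y : P y -> U (permutations (enum F)) y.
  move=> Py; split=> //; have [s s_perm s_sorted] := dec_order F y.
  by exists s; rewrite // mem_permutations.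
have U_min L : {subset L <= permutations (enum F)} -> (exists y, U L y) ->
  exists2 x, P x & forall y, U L y ->
    ((dec_sorted F x : seqlexi R) <= (dec_sorted F y : seqlexi R))%O.
  elim: L => [_ [y [_ []//]]|s L IHL sL U0].
  have s_perm : perm_eq s (enum F) by rewrite -mem_permutations sL ?mem_head.
  have {}sL : {subset L <= permutations (enum F)}.
    by move=> t tL; apply: sL; rewrite inE tL orbT.
  have Us y : U (s :: L) y -> P y /\ sorted >=%R (map y s) \/ U L y.
    move=> [Py [t]]; rewrite inE => /predU1P[->|tL] t_sorted; first by left.
    by right; split=> //; exists t.
  have [Ps0|Ps0] := pselect (exists y, P y /\ sorted >=%R (map y s)); last first.
    have nPs y : U (s :: L) y -> U L y.
      by move=> /Us[Psy|//]; case: Ps0; exists y.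
    have [|x Px x_min] := IHL sL; first by case: U0 => y /nPs; exists y.
    by exists x => // y /nPs /x_min.
  have [||x1 [Px1 x1s] x1_min] := @lexmin_attained _ _ s _ _ Ps0.
  - exact: polyhedral_and (polyhedral_sorted s).
  - move=> e; rewrite (perm_mem s_perm) mem_enum => /bnd[m mP].
    by exists m => x [/mP].
  have x1P y : P y /\ sorted >=%R (map y s) ->
    ((dec_sorted F x1 : seqlexi R) <= (dec_sorted F y : seqlexi R))%O.
    move=> Psy; rewrite (dec_sortedE s_perm x1s) (dec_sortedE s_perm Psy.2).
    exact: x1_min.
  have [UL0|UL0] := pselect (exists y, U L y); last first.
    by exists x1 => // y /Us[/x1P//|ULy]; case: UL0; exists y.
  have [x2 Px2 x2_min] := IHL sL UL0.
  have [le12|le21] := leP (dec_sorted F x1 : seqlexi R) (dec_sorted F x2).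
    by exists x1 => // y /Us[/x1P//|/x2_min]; apply: le_trans.
  by exists x2 => // y /Us[/x1P|/x2_min//]; apply/le_trans/ltW.
have [//||x Px x_min] := U_min (permutations (enum F)).
  by exists x0; apply: Uall.
by exists x => // y /Uall /x_min.
Qed.

End DecreasingOrder.

(** * Finite sets of [p], bounded sets and jumping edges *)

Section BasePolyhedra.
Context {R : realType} {V : finType} (p : {set V} -> \bar int).
Context (p_base : int_base_function p) (pV0 : p [set: V]%SET = 0%E).
Implicit Types (X Y Z : {set V}) (u v : V).

Definition finite_on Z : bool := p Z \is a fin_num.

Lemma finite_onP Z : reflect (exists k : int, p Z = k%:E%E) (finite_on Z).
Proof.
apply: (iffP idP) => [/fineK <-|[k pZk]]; first by eexists.
by rewrite /finite_on pZk.
Qed.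

Lemma not_finite_on Z : ~~ finite_on Z -> p Z = -oo%E.
Proof.
case: p_base => pNy _ _ _; rewrite /finite_on.
by have := pNy Z; case: (p Z) => // k.
Qed.

(** Supermodularity keeps both right-hand values above [-oo], and [+oo] is excluded. *)
Lemma finite_onIU X Y : finite_on X -> finite_on Y ->
  finite_on (X :&: Y) /\ finite_on (X :|: Y).
Proof.
case: p_base => pNy _ _ /(_ X Y) + /finite_onP[k pX] /finite_onP[l pY].
rewrite /finite_on pX pY; have := pNy (X :&: Y); have := pNy (X :|: Y).
by case: (p (X :&: Y)) (p (X :|: Y)) => [i||] [j||].
Qed.

Lemma finite_onT : finite_on [set: V].
Proof. by case: p_base. Qed.

Lemma finite_on_smallest u : exists Z, [/\ finite_on Z, u \in Z &
  forall Y, finite_on Y -> u \in Y -> Z \subset Y].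
Proof.
exists (\bigcap_(Y | finite_on Y && (u \in Y)) Y)%SET; split.
- apply: (big_ind finite_on) => [|X Y|Y /andP[]//]; first exact: finite_onT.
  by move=> finX /(finite_onIU finX)[].
- by apply/bigcapP => Y /andP[].
- by move=> Y finY uY; apply: (finset.bigcap_inf Y); rewrite finY.
Qed.

(** If no such pair leaves [Z], then [Z] is the union of the smallest finite sets around its
    elements, hence finite; the empty union is covered by [p] vanishing on the empty set. *)
Lemma not_finite_on_witness Z : ~~ finite_on Z ->
  exists u v, [/\ u \in Z, v \notin Z &
    forall Y, finite_on Y -> u \in Y -> v \in Y].
Proof.
apply: contraNP => no_uv.
have [P smallP] := choice finite_on_smallest.
have -> : Z = (\bigcup_(u in Z) P u)%SET.
  apply/setP => v; apply/idP/bigcupP => [vZ|[u uZ vPu]].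
    by exists v => //; case: (smallP v).
  apply: contra_notT no_uv => vZ; exists u, v; split=> // Y finY uY.
  by case: (smallP u) => _ _ /(_ Y finY uY) /fintype.subsetP; apply.
apply: (big_ind finite_on) => [|X Y finX /(finite_onIU finX)[]//|u _].
  by rewrite /finite_on; case: p_base => _ ->.
by case: (smallP u).
Qed.

Lemma base_polyhedronP (x : V -> R) :
  base_polyhedron p x <-> sum_on x [set: V]%SET = 0 /\
    forall Z (k : int), p Z = k%:E%E -> k%:~R <= sum_on x Z.
Proof.
rewrite /base_polyhedron /= pV0; split=> -[xV px]; split.
- by case: xV.
- by move=> Z k pZ; have := px Z; rewrite pZ lee_fin.
- by rewrite xV.
- move=> Z; have [/finite_onP[k pZ]|/not_finite_on ->] := boolP (finite_on Z).
    by rewrite pZ lee_fin px.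
  exact: leNye.
Qed.

(** Identifies the family of bounded sets with the sets on which [p] is finite. The point [x]
    matters: over an empty polyhedron the infimum is [+oo] and every set would count as bounded. *)
Lemma bounded_family_finite_on (x : V -> R) Z : base_polyhedron p x ->
  bounded_family (base_polyhedron p : set (V -> R)) Z <-> finite_on Z.
Proof.
move=> /base_polyhedronP[xV px]; split; last first.
  move=> /finite_onP[k pZ]; rewrite /bounded_family /=.
  apply: (@lt_le_trans _ _ (k%:~R%:E)%E); first exact: ltNyr.
  apply: le_ereal_inf_tmp => _ [y /base_polyhedronP[_ py] <-].
  by rewrite lee_fin py.
apply: contraPT => /not_finite_on_witness[u [v [uZ vZ uv]]].
(* Moving mass from [u] to [v] stays in the polyhedron and lowers the sum on
   [Z] without bound. *)
pose y (t : R) w : R := x w + t * ((w == v)%:R - (w == u)%:R).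
have sum_y t Y : sum_on (y t) Y = sum_on x Y + t * ((v \in Y)%:R - (u \in Y)%:R).
  rewrite /sum_on big_split /= -mulr_sumr sumrB.
  have sum1 w : \sum_(i in Y) (i == w)%:R = (w \in Y)%:R :> R.
    have [wY|wY] := boolP (w \in Y); last first.
      by rewrite big1 // => i iY; case: eqP wY => // <-; rewrite iY.
    by rewrite (bigD1 w) //= eqxx big1 ?addr0 // => i /andP[_ /negbTE ->].
  by rewrite !sum1.
have le_inf t : 0 <= t ->
    (ereal_inf [set (sum_on x Z)%:E | x in base_polyhedron p]
     <= (sum_on x Z - t)%:E)%E.
  move=> t_ge0; apply: ereal_inf_lbound; exists (y t); last first.
    by rewrite sum_y uZ (negbTE vZ) sub0r mulrN1.
  apply/base_polyhedronP; rewrite sum_y !inE subrr mulr0 addr0; split=> // Y k pY.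
  (* A finite [Y] containing [u] contains [v], so the shift never lowers the sum on [Y]. *)
  rewrite sum_y; apply: le_trans (px Y k pY) _; rewrite lerDl mulr_ge0 //.
  rewrite subr_ge0 ler_nat; case: (boolP (u \in Y)) => // uY.
  by rewrite uv //; apply/finite_onP; exists k.
rewrite /bounded_family /=; case: ereal_inf le_inf => [r||] le_inf //; last first.
  by have := le_inf 0 (lexx 0).
(* A shift by [t = |sum_on x Z - r| + 1] already brings the sum on [Z] below the supposed finite
   infimum [r]. *)
have r_ge0 := normr_ge0 (sum_on x Z - r).
move: (le_inf _ (addr_ge0 r_ge0 ler01)); rewrite lee_fin => {le_inf} + _.
by have := ler_norm (sum_on x Z - r); lra.
Qed.

Lemma jumpingP (x : V -> R) u v : base_polyhedron p x ->
  jumping (base_polyhedron p : set (V -> R)) u v <->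
  u != v /\ forall Y, finite_on Y -> u \in Y -> v \in Y.
Proof.
move=> px; have bnd Y := bounded_family_finite_on Y px.
have [Z [finZ uZ Zmin]] := finite_on_smallest u.
split=> [[Y [/bnd finY uY Ymin]]|[uv finuv]].
  rewrite !inE eq_sym => /andP[uv vY]; split=> // X finX uX.
  by have /fintype.subsetP := Ymin X (proj2 (bnd X) finX) uX; apply.
exists Z; first by split=> [|//|Y /bnd]; [apply/bnd|apply: Zmin].
by rewrite !inE eq_sym uv finuv.
Qed.

End BasePolyhedra.

(** * Linear description of the flow polyhedron *)

Section SubmodularFlows.
Context {R : realType} {V A : finType} (src tgt : A -> V) (F : {set A}).
Context (p : {set V} -> \bar int).
Context (p_base : int_base_function p) (pV0 : p [set: V]%SET = 0%E).
Context (f g : A -> \bar int).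
Context (f_npinfty : forall e, f e != +oo%E) (g_nninfty : forall e, g e != -oo%E).
Implicit Types (Z : {set V}) (x : A -> R) (e : A).

Local Notation B := (base_polyhedron p : set (V -> R)).
Local Notation Q := (flow_polyhedron src tgt f g B).
Local Notation star_edge := (@star_edge V A).
Local Notation ssrc := (star_src src tgt : star_edge -> V).
Local Notation stgt := (star_tgt src tgt : star_edge -> V).
Local Notation in_Dstar := (in_star F f g B).

(** The coefficient of [x e] in the net inflow of [Z]: 1 if [e] enters, -1 if it leaves, 0
    otherwise. *)
Definition entering Z e : R := (tgt e \in Z)%:R - (src e \in Z)%:R.

Lemma sum_on_psi x Z : sum_on (psi src tgt x) Z = \sum_e entering Z e * x e.
Proof.
have sum1 (h : A -> V) :
    \sum_(v in Z) \sum_(e | h e == v) x e = \sum_e (h e \in Z)%:R * x e.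
  rewrite (exchange_big_dep predT) //=; apply: eq_bigr => e _.
  have [hZ|hZ] := boolP (h e \in Z).
    rewrite (big_pred1 (h e)) ?mul1r // => v.
    by rewrite /= eq_sym; case: eqP => [->|]; rewrite ?hZ ?andbF.
  rewrite big_pred0 ?mul0r // => v.
  by case: eqP hZ => [->|_ _]; rewrite ?andbF // => /negbTE ->.
rewrite /sum_on sumrB !sum1 -sumrB.
by apply: eq_bigr => e _; rewrite mulrBl.
Qed.

Lemma flowP x : Q x <->
  [/\ forall e (k : int), f e = k%:E%E -> k%:~R <= x e,
      forall e (k : int), g e = k%:E%E -> x e <= k%:~R &
      forall Z (k : int), p Z = k%:E%E -> k%:~R <= \sum_e entering Z e * x e].
Proof.
rewrite /flow_polyhedron /= base_polyhedronP //; split.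
  move=> [fxg [_ px]]; split=> [e k fe|e k ge|Z k pZ].
  - by have /andP[] := fxg e; rewrite fe lee_fin.
  - by have /andP[] := fxg e; rewrite ge lee_fin.
  - by rewrite -sum_on_psi px.
move=> [fx xg px]; split=> [e|].
  apply/andP; split.
    case fe: (f e) (f_npinfty e) => [k||] // _; last exact: leNye.
    by rewrite lee_fin fx.
  case ge: (g e) (g_nninfty e) => [k||] // _; last exact: leey.
  by rewrite lee_fin xg.
split=> [|Z k pZ]; last by rewrite sum_on_psi px.
(* Each edge has both ends in [V], so the net inflow of [V] is 0, which is [p] of [V]. *)
rewrite sum_on_psi big1 // => e _.
by rewrite /entering !inE subrr mul0r.
Qed.

Lemma polyhedral_flow : polyhedral Q.
Proof.
have polyf e : polyhedral (fun x =>
      forall k : int, f e = k%:E%E -> k%:~R <= x e).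
  case: (f e) => [k||]; last 2 first.
  - by apply: polyhedral_ext polyhedral_true => x; split.
  - by apply: polyhedral_ext polyhedral_true => x; split.
  apply: polyhedral_ext (polyhedral_ge_const e k%:~R) => x.
  by split=> [le_k _ [<-]|/(_ k erefl)].
have polyg e : polyhedral (fun x =>
      forall k : int, g e = k%:E%E -> x e <= k%:~R).
  case: (g e) => [k||]; last 2 first.
  - by apply: polyhedral_ext polyhedral_true => x; split.
  - by apply: polyhedral_ext polyhedral_true => x; split.
  apply: polyhedral_ext (polyhedral_le_const e k%:~R) => x.
  by split=> [le_k _ [<-]|/(_ k erefl)].
have polyp Z : polyhedral (fun x => forall k : int, p Z = k%:E%E ->
    k%:~R <= \sum_e entering Z e * x e).
  case: (p Z) => [k||]; last 2 first.
  - by apply: polyhedral_ext polyhedral_true => x; split.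
  - by apply: polyhedral_ext polyhedral_true => x; split.
  apply: polyhedral_ext
    (polyhedral_halfspace (fun e => - entering Z e) (- k%:~R)) => x.
  under eq_bigr do rewrite mulNr.
  by rewrite sumrN lerN2; split=> [le_k _ [<-]|/(_ k erefl)].
apply: polyhedral_ext (polyhedral_and (polyhedral_forall polyf)
  (polyhedral_and (polyhedral_forall polyg) (polyhedral_forall polyp))) => x.
by rewrite flowP; split=> [[? []]|[]].
Qed.

(** * Reachability in [D^*] and existence of a dec-min element *)

Definition star_rel (u v : V) : bool :=
  `[< exists a, [/\ in_Dstar a, ssrc a = u & stgt a = v] >].

(** Lifts a vertex path to star edges. Recording their sources as [belast] lets distinctness of the
    vertices carry over to the edges. *)
Lemma star_walk (a0 : star_edge) (q : seq V) : path star_rel (stgt a0) q ->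
  exists c, [/\ forall a, a \in c -> in_Dstar a,
    map ssrc c = belast (stgt a0) q,
    path (fun a b => stgt a == ssrc b) a0 c &
    stgt (last a0 c) = last (stgt a0) q].
Proof.
elim: q a0 => [|v q IHq] a0 /=; first by exists [::].
move=> /andP[/asboolP[a [a_star a_src av]]]; rewrite -av => /IHq[c].
move=> [c_star c_src c_path c_last]; exists (a :: c); split=> //=.
- by move=> b; rewrite inE => /predU1P[->|/c_star].
- by rewrite c_src a_src.
- by rewrite a_src eqxx.
Qed.

(** The copy of [e] closes a simple path from its head to its tail; the sources of the resulting
    circuit are the path's vertices with the last one moved to the front. *)
Lemma star_circuit_of_connect e : e \in F -> f e = -oo%E ->
  connect star_rel (tgt e) (src e) -> star_circuit_through_F src tgt F f g B.
Proof.
move=> eF fe /connectP[q0 /shortenP[q q_path q_uniq _] srce] {q0}.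
pose a0 : star_edge := inr (inl e).
have [c [c_star c_src c_path c_last]] := @star_walk a0 q q_path.
exists (a0 :: c); split; last by exists e; rewrite // mem_head.
split=> //=.
- by move=> a; rewrite inE => /predU1P[->|/c_star].
- by rewrite rcons_path c_path c_last /= srce eqxx.
- rewrite /= c_src /= srce.
  by move: q_uniq; rewrite lastI rcons_uniq.
Qed.

Lemma flow_coordinate_bounded_below (M : R) e (x0 : A -> R) : Q x0 ->
    ~ star_circuit_through_F src tgt F f g B -> e \in F ->
  exists m : R, forall x, Q x /\ (forall e, e \in F -> x e <= M) -> m <= x e.
Proof.
move=> /= Qx0 noC eF; case fe: (f e) (f_npinfty e) => [k||] // _.
  by exists k%:~R => x [/flowP[fx _ _] _]; apply: fx.
pose S := [set v | connect star_rel (tgt e) v].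
have tS : tgt e \in S by rewrite inE.
have sS : src e \notin S.
  by rewrite inE; apply/negP => /(star_circuit_of_connect eF fe).
have S_closed a : in_Dstar a -> ssrc a \in S -> stgt a \in S.
  move=> a_star; rewrite !inE => /connect_trans; apply; apply: connect1.
  by apply/asboolP; exists a.
(* Otherwise some jumping edge would leave [S]. *)
have /finite_onP[k pS] : finite_on p S.
  apply: contraT => /(not_finite_on_witness p_base)[u [v [uS vS uv]]].
  suff : v \in S by rewrite (negbTE vS).
  apply: (S_closed (inl (u, v))) => //=; apply/(jumpingP p_base pV0 _ _ Qx0.2).
  by split=> //; apply: contraNneq vS => <-.
(* An entering edge is bounded above by [M] if in [F] and by [g] otherwise, a leaving edge below by
   [f]; an infinite bound would put into [D^*] an edge leaving [S]. *)
have bnd e' : exists c, forall x,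
    Q x /\ (forall e, e \in F -> x e <= M) -> entering S e' * x e' <= c.
  rewrite /entering.
  have [tS'|tS'] := boolP (tgt e' \in S); have [sS'|sS'] := boolP (src e' \in S).
  - by exists 0 => x _; rewrite subrr mul0r.
  - have [e'F|e'F] := boolP (e' \in F).
      by exists M => x [_ /(_ _ e'F)]; rewrite subr0 mul1r.
    case ge: (g e') (g_nninfty e') => [l||] // _.
      by exists l%:~R => x [/flowP[_ xg _] _]; rewrite subr0 mul1r xg.
    by have := S_closed (inr (inr e')) (conj e'F ge) tS'; rewrite /= (negbTE sS').
  - case fe': (f e') (f_npinfty e') => [l||] // _.
      exists (- l%:~R) => x [/flowP[fx _ _] _].
      by rewrite sub0r mulN1r lerN2 fx.
    by have := S_closed (inr (inl e')) fe' sS'; rewrite /= (negbTE tS').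
  - by exists 0 => x _; rewrite subrr mul0r.
have [c cP] := choice bnd.
(* In the inequality for [S], the edge [e] has coefficient 1 and every other term is at most
   [c e']. *)
exists (k%:~R - \sum_(e' | e' != e) c e') => x Qx.
have /flowP[_ _ /(_ S k pS)] := Qx.1.
rewrite (bigD1 e) //= {1}/entering tS (negbTE sS) subr0 mul1r lerBlDr.
move=> /le_trans; apply; rewrite lerD2l; apply: ler_sum => e' _.
exact: cP.
Qed.

Lemma dec_min_exists (x0 : A -> R) : Q x0 ->
  ~ star_circuit_through_F src tgt F f g B -> exists z, dec_min F Q z.
Proof.
move=> Qx0 noC.
have [M MP] : exists M, forall e, e \in F -> x0 e <= M.
  exists (\sum_e `|x0 e|) => e _; rewrite (bigD1 e) //=.
  by apply: le_trans (ler_norm _) _; rewrite lerDl sumr_ge0.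
pose P x := Q x /\ forall e, e \in F -> x e <= M.
have polyP : polyhedral P.
  apply: polyhedral_and polyhedral_flow _.
  by apply: polyhedral_forall => e; apply/polyhedral_impl/polyhedral_le_const.
have [||z [Qz zM] z_min] := dec_min_attained (F := F) polyP.
- by exists x0.
- by move=> e eF; apply: flow_coordinate_bounded_below Qx0 noC eF.
exists z; split=> // -[y Qy y_lt].
(* Anything decreasingly smaller than [z] still respects the bound [M], so minimality within [P]
   suffices. *)
have /z_min : P y by split=> //; apply: dec_smaller_bound y_lt zM.
by rewrite leNgt => /negP; apply.
Qed.

(** * Pushing a flow along a circuit of [D^*] *)

Definition star_shift (a : star_edge) e : R :=
  match a with
  | inl _ => 0
  | inr (inl e') => - (e' == e)%:R
  | inr (inr e') => (e' == e)%:R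
  end.

(** Equality holds for copies of edges. A jumping edge leaves the flow unchanged, but the left side
    is then at most 0, since no jumping edge leaves a finite set. *)
Lemma sum_star_shift_ge (a : star_edge) (Z : {set V}) (x0 : A -> R) :
    Q x0 -> in_Dstar a -> finite_on p Z ->
  (ssrc a \in Z)%:R - (stgt a \in Z)%:R <= \sum_e entering Z e * star_shift a e.
Proof.
move=> [_ Bx0].
have sum1 e' : \sum_e entering Z e * (e' == e)%:R = entering Z e'.
  by under eq_bigr do rewrite mulrC eq_sym; rewrite sum_delta.
case: a => [[u v]|[e|e]] /=.
- move=> /(jumpingP p_base pV0 _ _ Bx0)[_ uv] finZ.
  rewrite big1 => [|e _]; last by rewrite mulr0.
  rewrite subr_le0 ler_nat; case: (boolP (u \in Z)) => // uZ.
  by rewrite uv.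
- move=> _ _; under eq_bigr do rewrite mulrN.
  by rewrite sumrN sum1 /entering opprB.
- by move=> _ _; rewrite sum1.
Qed.

(** Along a closed walk the list of heads is a rotation of the list of tails. *)
Lemma sum_cycle (c : seq star_edge) (h : V -> R) :
  cycle (fun a b => stgt a == ssrc b) c ->
  \sum_(a <- c) (h (ssrc a) - h (stgt a)) = 0.
Proof.
case: c => [|a c]; first by rewrite big_nil.
rewrite sumrB /= => c_cycle.
have map_tgt b s : path (fun a b => stgt a == ssrc b) b s ->
    map stgt (belast b s) = map ssrc s.
  by elim: s b => //= d s IHs b /andP[/eqP -> /IHs ->].
have := map_tgt _ _ c_cycle; rewrite belast_rcons => tgtE.
rewrite -(big_map ssrc predT h) -(big_map stgt predT h) tgtE map_rcons.
by rewrite [X in _ - X](perm_big (map ssrc (a :: c))) ?subrr // perm_rcons.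
Qed.

Lemma no_dec_min_of_circuit z :
  star_circuit_through_F src tgt F f g B -> ~ dec_min F Q z.
Proof.
move=> [c [[_ c_star c_cycle _] [e0 e0F e0c]]] [Qz]; apply.
pose z' e := z e + \sum_(a <- c) star_shift a e.
(* Only a copy of [e] in its own orientation lowers [z e], and it is present only if [f e = -oo]. *)
have shift_ge0 e : f e != -oo%E -> 0 <= \sum_(a <- c) star_shift a e.
  move=> fe; rewrite big_seq sumr_ge0 // => -[uv|[e'|e']] //= /c_star //= fe'.
  by rewrite oppr_ge0; case: (eqVneq e' e) fe => [<-|_ _]; rewrite ?fe' ?eqxx ?lexx.
have shift_term_le0 e a : (e \in F) || (g e != +oo%E) -> a \in c ->
    star_shift a e <= 0.
  move=> eFg /c_star; case: a => [uv|[e'|e']] //= [e'F ge'].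
  by case: (eqVneq e' e) eFg => [<-|_ _]; rewrite ?(negbTE e'F) ?ge' ?lexx.
have shift_le0 e : (e \in F) || (g e != +oo%E) ->
    \sum_(a <- c) star_shift a e <= 0.
  by move=> eFg; rewrite big_seq sumr_le0 // => a; apply: shift_term_le0.
exists z'; last first.
  apply: (@dec_smaller_le _ _ _ _ _ e0) => // [e eF|]; rewrite /z'.
    by rewrite gerDl shift_le0 ?eF.
  (* One occurrence of [e0] contributes -1, and no other term is positive on an edge of [F]. *)
  rewrite gtrDl (big_rem _ e0c) /= eqxx.
  apply: (@le_lt_trans _ _ (-1)); last by rewrite oppr_lt0.
  rewrite gerDl big_seq sumr_le0 // => a /mem_rem; apply: shift_term_le0.
  by rewrite e0F.
have /flowP[fz zg pz] := Qz; apply/flowP; split=> [e k fe|e k ge|Z k pZ].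
- by rewrite -[leLHS]addr0 lerD ?fz ?shift_ge0 ?fe.
- by rewrite -[leRHS]addr0 lerD ?zg ?shift_le0 ?ge ?orbT.
rewrite -[leLHS]addr0; under eq_bigr do rewrite mulrDr mulr_sumr.
rewrite big_split /= lerD ?pz // exchange_big /=.
(* Writing 0 as the cyclic sum of differences of the indicator of [Z] reduces the claim to one
   inequality per circuit edge. *)
rewrite -[leLHS](@sum_cycle c (fun v => (v \in Z)%:R)) //.
rewrite big_seq [leRHS]big_seq; apply: ler_sum => a /c_star a_star.
by apply: sum_star_shift_ge Qz a_star _; apply/finite_onP; exists k.
Qed.

End SubmodularFlows.

(** * Existence of a dec-min element characterized by circuits *)

Theorem theorem7p3 (R : realType) (V A : finType) (src tgt : A -> V)
    (loopless : forall e, src e != tgt e)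
    (F : {set A}) (F_neq0 : F != finset.set0)
    (B : set (V -> R)) (B_base : integral_0_base_polyhedron B)
    (f g : A -> \bar int)
    (f_npinfty : forall e, f e != +oo%E) (g_nninfty : forall e, g e != -oo%E)
    (le_fg : forall e, (f e <= g e)%E)
    (Q_neq0 : (flow_polyhedron src tgt f g B !=set0)%classic) :
  (exists z : A -> R, dec_min F (flow_polyhedron src tgt f g B) z)
  <-> ~ star_circuit_through_F src tgt F f g B.
Proof.
case: B_base => p [p_base pV0 ->] in Q_neq0 *.
split=> [[z z_min] C|noC]; first exact: no_dec_min_of_circuit C z_min.
by case: Q_neq0 => x0 Qx0; apply: dec_min_exists Qx0 noC.
Qed.
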